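(* Let $B$ be a Banach space, let $0\le \alpha<\frac12$, let $X$ be a paracompact space, and let $F:X\to bexp_\alpha(B)$ be a continuous mapping, where $bexp_\alpha(B)$ is the family of all bounded $\alpha$-paraconvex subsets of $B$ endowed with the Hausdorff metric. Then there exists a continuous singlevalued mapping $\mathfrak{F}:X\to C_b(B,B)$, $x\mapsto \mathfrak{F}_x$, such that for every $x\in X$ the mapping $\mathfrak{F}_x:B\to B$ is a continuous retraction of $B$ onto the set $F(x)$.
   Context: For a number $\alpha\ge 0$, a nonempty closed subset $P$ of a normed space $Y$ is called $\alpha$-paraconvex if for every $r>0$, every open ball $D_r\subset Y$ of radius $r$ and every $q\in \mathrm{conv}(P\cap D_r)$ one has $\mathrm{dist}(q,P)\le \alpha\cdot r$. For $0\le\alpha<1$ and a Banach space $B$, $bexp_\alpha(B)$ is the family of all $\alpha$-paraconvex bounded subsets of $B$ endowed with the Hausdorff metric; the Hausdorff distance between two bounded sets is the infimum of all $\varepsilon>0$ such that each of the sets is contained in the open $\varepsilon$-neighborhood of the other. $C_b(B,B)$ is the Banach space of all continuous bounded mappings of $B$ into itself, with the sup norm. A continuous retraction of $B$ onto $A\subset B$ is a continuous map $R:B\to B$ with $R(B)\subset A$ and $R(a)=a$ for all $a\in A$. *)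

(* Defs.v *)
From HB Require Import structures.
From mathcomp Require Import all_boot all_order all_algebra.
From mathcomp Require Import all_classical all_reals all_analysis.
Set Implicit Arguments.
Unset Strict Implicit.
Unset Printing Implicit Defensive.
Import Order.TTheory GRing.Theory Num.Theory.
Import numFieldNormedType.Exports.
Local Open Scope classical_set_scope.
Local Open Scope ring_scope.

(* Separation axioms are not part of this notion of paracompactness. *)
Definition locally_finite (T : topologicalType) (V : set (set T)) :=
  forall x : T, exists2 N : set T,
    nbhs x N & finite_set [set A | V A /\ A `&` N !=set0].

Definition open_cover (T : topologicalType) (U : set (set T)) :=
  U `<=` open /\ \bigcup_(A in U) A = setT.

Definition refines (T : Type) (V U : set (set T)) :=
  forall A, V A -> exists2 C, U C & A `<=` C.

Definition paracompact_space (T : topologicalType) :=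
  forall U : set (set T), open_cover U ->
    exists V : set (set T), [/\ open_cover V, refines V U & locally_finite V].

Definition convex_hull (R : realType) (Y : normedModType R) (A : set Y) : set Y :=
  smallest (@convex_set R Y) A.

Definition paraconvex (R : realType) (Y : normedModType R) (alpha : R)
    (P : set Y) :=
  [/\ P !=set0, closed P &
    forall (r : R) (c q : Y), 0 < r -> convex_hull (P `&` ball c r) q ->
      (edist_inf P q <= (alpha * r)%:E)%E].

Definition open_nbhd (R : realType) (Y : normedModType R) (e : R) (A : set Y) :
  set Y := \bigcup_(a in A) ball a e.

Definition hausdorff_dist (R : realType) (Y : normedModType R)
    (A C : set Y) : R :=
  inf [set e | [/\ 0 < e, A `<=` open_nbhd e C & C `<=` open_nbhd e A]].

Record bexp (R : realType) (B : normedModType R) (alpha : R) := Bexp {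
  bexp_set :> set B ;
  bexp_paraconvex : paraconvex alpha bexp_set ;
  bexp_bounded : bounded_set bexp_set }.

Arguments bexp {R} B alpha.

Section bexp_metric.
Context (R : realType) (B : normedModType R) (alpha : R).
Implicit Types P Q S : bexp B alpha.

HB.instance Definition _ := gen_eqMixin (bexp B alpha).
HB.instance Definition _ := gen_choiceMixin (bexp B alpha).

Let hset (P Q : set B) :=
  [set e : R | [/\ 0 < e, P `<=` open_nbhd e Q & Q `<=` open_nbhd e P]].

Let hset_lb (P Q : set B) : lbound (hset P Q) 0.
Proof. by move=> e [/ltW]. Qed.

Let hset_inf P Q : has_inf (hset P Q).
Proof.
split; last by exists 0; exact: hset_lb.
have /ex_strict_bound_gt0[M M0 PM] := bexp_bounded P.
have /ex_strict_bound_gt0[N N0 QN] := bexp_bounded Q.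
have [[p Pp] _ _] := bexp_paraconvex P.
have [[q Qq] _ _] := bexp_paraconvex Q.
exists (M + N); split; first exact: addr_gt0.
- move=> x Px; exists q => //; rewrite -ball_normE /=.
  by rewrite (le_lt_trans (ler_normB _ _))// addrC ltrD// ?(PM x Px) ?(QN q Qq).
- move=> x Qx; exists p => //; rewrite -ball_normE /=.
  by rewrite (le_lt_trans (ler_normB _ _))// ltrD// ?(PM p Pp) ?(QN x Qx).
Qed.

Let hset_ge0 P Q : 0 <= hausdorff_dist P Q.
Proof. by apply: lb_le_inf; [have [] := hset_inf P Q|exact: hset_lb]. Qed.

Lemma hausdorff_distxx P : hausdorff_dist P P = 0.
Proof.
apply/eqP; rewrite eq_le hset_ge0 andbT; apply/ler_addgt0Pl => e e0.
rewrite addr0; apply: ge_inf; first by exists 0; exact: hset_lb.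
by split=> // x Px; exists x => //; exact: ballxx.
Qed.

Lemma hausdorff_distC P Q : hausdorff_dist P Q = hausdorff_dist Q P.
Proof.
by congr inf; apply/seteqP; split=> e [e0 PQ QP]; split.
Qed.

Let hausdorff_dist0_sub P Q : hausdorff_dist P Q = 0 -> bexp_set P `<=` bexp_set Q.
Proof.
move=> PQ0 x Px; have [_ + _] := bexp_paraconvex Q; apply => A.
rewrite -nbhs_ballE => -[/= e e0 eA].
have [d [d0 PQ _] de] := inf_adherent e0 (hset_inf P Q).
rewrite [inf _]PQ0 add0r in de.
have [q Qq qx] := PQ _ Px.
by exists q; split=> //; apply: eA; exact/ball_sym/(le_ball (ltW de)).
Qed.

Lemma hausdorff_dist_eq P Q : hausdorff_dist P Q = 0 -> P = Q.
Proof.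
move=> PQ0; have : bexp_set P = bexp_set Q.
  apply/seteqP; split; apply: hausdorff_dist0_sub => //.
  by rewrite hausdorff_distC.
case: P Q {PQ0} => [P pP bP] [Q pQ bQ] /= PQ; subst Q.
by congr Bexp; exact: Prop_irrelevance.
Qed.

Lemma hausdorff_dist_triangle Q P S :
  hausdorff_dist P S <= hausdorff_dist P Q + hausdorff_dist Q S.
Proof.
apply/ler_addgt0Pr => e e0; have e20 : 0 < e / 2 by rewrite divr_gt0.
have [a [a0 PQ QP] ae] := inf_adherent e20 (hset_inf P Q).
have [b [b0 QS SQ] be] := inf_adherent e20 (hset_inf Q S).
apply: (@le_trans _ _ (a + b)); last first.
  by rewrite [e in leRHS]splitr addrACA lerD// ltW.
apply: ge_inf; first by exists 0; exact: hset_lb.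
split; first exact: addr_gt0.
- move=> x /PQ[q /QS[s Ss sq] qx]; exists s => //.
  by rewrite addrC; exact: ball_triangle qx.
- by move=> x /SQ[q /QP[p Pp pq] qx]; exists p => //; exact: ball_triangle qx.
Qed.

HB.instance Definition _ := @isMetric.Build R (bexp B alpha)
  (fun P Q => hausdorff_dist P Q) hausdorff_distxx hausdorff_dist_eq
  hausdorff_distC hausdorff_dist_triangle.

End bexp_metric.

Definition bcontinuous (R : realType) (T : topologicalType)
    (V : normedModType R) : {pred T -> V} :=
  mem [set f : T -> V | continuous f /\ bounded_fun f].

Record Cb (R : realType) (T : topologicalType) (V : normedModType R) := MkCb {
  Cb_fun :> T -> V ;
  _ : Cb_fun \in @bcontinuous R T V }.

Arguments Cb {R} T V.

Section Cb_normed.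
Context (R : realType) (T : topologicalType) (V : normedModType R).

HB.instance Definition _ := [isSub for @Cb_fun R T V].
HB.instance Definition _ := [Choice of Cb T V by <:].

Lemma CbP (f : Cb T V) : continuous f /\ bounded_fun f.
Proof. by have := valP f; rewrite /= inE. Qed.

Lemma bcontinuous_submod_closed : submod_closed (@bcontinuous R T V).
Proof.
split; first by rewrite inE; split; [exact: cst_continuous|exact: (bounded_cst (0 : V))].
move=> a f g /[!inE] -[cf bf] [cg bg]; split.
  move=> x; apply: cvgD; last exact: cg.
  by apply: cvgZ; [exact: cvg_cst|exact: cf].
have [M M0 fM] := ex_strict_bound_gt0 bf.
have [N N0 gN] := ex_strict_bound_gt0 bg.
exists (`|a| * M + N); split=> [|K /ltW MNK x _ /=]; first exact: num_real.
rewrite (le_trans _ MNK)// (le_trans (ler_normD _ _))// lerD ?(ltW (gN x _))//.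
by rewrite normrZ ler_wpM2l// ltW// (fM x).
Qed.

HB.instance Definition _ := GRing.isSubmodClosed.Build _ _ (@bcontinuous R T V)
  bcontinuous_submod_closed.
HB.instance Definition _ := [SubChoice_isSubLmodule of Cb T V by <:].

Definition Cb_norm (f : Cb T V) : R := sup [set `|f x| | x in setT].

Let Cb_norm_ub (f : Cb T V) : has_ubound [set `|f x| | x in setT].
Proof.
have [_ /ex_strict_bound_gt0[M _ fM]] := CbP f.
by exists M => _ [x _ <-]; apply/ltW/fM.
Qed.

Lemma ler_Cb_norm (f : Cb T V) (x : T) : `|f x| <= Cb_norm f.
Proof. by apply: ub_le_sup; [exact: Cb_norm_ub|exists x]. Qed.

Let Cb_norm_ge0 (f : Cb T V) : 0 <= Cb_norm f.
Proof.
have [[_ [x _ _]]|ne] := pselect ([set `|f x| | x in setT] !=set0).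
  by rewrite (le_trans _ (ler_Cb_norm f x)).
by rewrite /Cb_norm sup_out// => -[].
Qed.

Let Cb_norm_le (f : Cb T V) (M : R) :
  0 <= M -> (forall x, `|f x| <= M) -> Cb_norm f <= M.
Proof.
move=> M0 fM; have [ne|ne] := pselect ([set `|f x| | x in setT] !=set0).
  by apply: ge_sup => // _ [x _ <-].
by rewrite /Cb_norm sup_out// => -[].
Qed.

Lemma Cb_normD (f g : Cb T V) : Cb_norm (f + g) <= Cb_norm f + Cb_norm g.
Proof.
apply: Cb_norm_le => [|x]; first by rewrite addr_ge0.
by rewrite (le_trans (ler_normD _ _))// lerD// ler_Cb_norm.
Qed.

Lemma Cb_normZ (a : R) (f : Cb T V) : Cb_norm (a *: f) = `|a| * Cb_norm f.
Proof.
have le b (g : Cb T V) : Cb_norm (b *: g) <= `|b| * Cb_norm g.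
  apply: Cb_norm_le => [|x]; first by rewrite mulr_ge0.
  by rewrite /= normrZ ler_wpM2l// ler_Cb_norm.
apply/eqP; rewrite eq_le le /=; have [->|a0] := eqVneq a 0.
  by rewrite normr0 mul0r.
rewrite -ler_pdivlMl ?normr_gt0// -normfV.
by rewrite -{1}[f](scalerK a0) le.
Qed.

Lemma Cb_norm_eq0 (f : Cb T V) : Cb_norm f = 0 -> f = 0.
Proof.
move=> f0; apply/val_inj/funext => x /=; apply/eqP.
by rewrite -normr_le0 -f0 ler_Cb_norm.
Qed.

HB.instance Definition _ := @Lmodule_isNormed.Build R (Cb T V)
  Cb_norm Cb_normD Cb_normZ Cb_norm_eq0.

End Cb_normed.

Definition continuous_retraction (T : topologicalType) (A : set T) (r : T -> T) :=
  [/\ continuous r, range r `<=` A & forall a, A a -> r a = a].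

(* Main.v *)
Require Import Defs.
From HB Require Import structures.
From mathcomp Require Import all_boot all_order all_algebra.
From mathcomp Require Import finmap.
From mathcomp Require Import all_classical all_reals all_analysis.
From mathcomp Require Import ring lra.
From mathcomp Require wochoice.
Import Order.TTheory GRing.Theory Num.Theory.
Import numFieldNormedType.Exports.
Local Open Scope classical_set_scope.
Local Open Scope ring_scope.
Set Implicit Arguments.
Unset Strict Implicit.
Unset Printing Implicit Defensive.

(* Since F factors through the metric space bexp_alpha(B), it suffices to
   select retractions continuously over that metric space. Michael's theorem
   for paraconvex-valued maps is applied twice. Over B minus P, with
   constant value P, it shows that a map f that is the identity near P and
   stays at distance < c from P is within c / (1 - gamma) of a retraction
   onto P, for any gamma > alpha. Hence the set of retractions onto P is
   gamma / (1 - gamma)-paraconvex in C_b(B, B), and gamma / (1 - gamma) < 1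
   can be achieved exactly when alpha < 1/2. Over bexp_alpha(B), with values
   the sets of retractions, it gives the theorem. For P |-> {retractions
   onto P} to be lower semicontinuous one must restrict to retractions f
   such that |f b - b| tends to 0 uniformly as b approaches P: the
   construction preserves this property. *)

(** * Partitions of unity on metric spaces *)

(** The well-ordering theorem, with [lt] the strict part of the order. It ranks the bumps below,
    each of which counts only for its excess over its predecessors. *)
Lemma well_founded_total_rel (T : choiceType) :
  exists lt : T -> T -> Prop,
    (forall x y, x != y -> lt x y \/ lt y x) /\
    forall A : set T, A !=set0 -> exists2 z, A z & forall y, lt y z -> ~ A y.
Proof.
have [r wo] := wochoice.well_ordering_principle T.
have woT : wochoice.wo_chain r predT by move=> A _; exact: wo.
exists (fun y z => ~~ r z y); split=> [x y xy|A [a Aa]].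
  apply/orP; rewrite -negb_and; apply: contra xy => ryx.
  by apply/eqP/(wochoice.wo_chain_antisymmetric woT) => //; rewrite andbC.
have [|z [[zA lbz] _]] := wo (mem A); first by exists a; rewrite inE.
exists z; first by rewrite inE in zA.
by move=> y /negP rzy Ay; apply: rzy; apply: lbz; rewrite inE.
Qed.

Section metric_partition.
Context (R : realType) (T : metricType R).

(** Over all pairs of points the one-sided inequality gives both bounds, and it passes directly to
    suprema and maxima. *)
Definition lipschitz_fun (k : R) (f : T -> R) :=
  forall x z, f x <= f z + k * mdist x z.

Lemma lipschitz_fun_continuous (k : R) (f : T -> R) :
  0 <= k -> lipschitz_fun k f -> continuous f.
Proof.
move=> k0 kf x; apply/cvgrPdist_lt => e e0.
have k1 : 0 < k + 1 by rewrite ltr_wpDl.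
apply/metricType_numDomainType.nbhs_mdistP.
exists (e / (k + 1)) => /=; first by rewrite divr_gt0.
move=> z /= xz.
have kd : k * mdist x z < e.
  apply: (@le_lt_trans _ _ ((k + 1) * mdist x z)).
    by rewrite ler_wpM2r ?mdist_ge0// lerDl.
  by rewrite mulrC -ltr_pdivlMr.
have := kf x z; have := kf z x; rewrite (metric_sym z).
move=> h1 h2; rewrite ltr_norml; lra.
Qed.

Lemma lipschitz_sup (I : Type) (A : set I) (g : I -> T -> R) (k M : R) :
  0 <= k -> (forall i, lipschitz_fun k (g i)) -> (forall i x, g i x <= M) ->
  lipschitz_fun k (fun x => sup [set g i x | i in A]).
Proof.
move=> k0 kg gM x z; have [->|/set0P[a Aa]] := eqVneq A set0.
  by rewrite !image_set0 !sup0 add0r mulr_ge0// mdist_ge0.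
apply: ge_sup => [|_ [i Ai <-]]; first by exists (g a x), a.
rewrite (le_trans (kg i x z))// lerD2r.
by apply: ub_le_sup; [exists M => _ [j _ <-]|exists i].
Qed.

Lemma lipschitz_max0 (k : R) (f : T -> R) :
  0 <= k -> lipschitz_fun k f -> lipschitz_fun k (fun x => Num.max 0 (f x)).
Proof.
move=> k0 kf x z; rewrite ge_max; apply/andP; split.
  by rewrite addr_ge0 ?mulr_ge0 ?mdist_ge0// le_max lexx.
by rewrite (le_trans (kf x z))// lerD2r le_max lexx orbT.
Qed.

(** Values at least [e] apart have distinct integer parts after division by [e], and these integer
    parts are bounded. *)
Lemma finite_separated (A : set T) (f : T -> R) (e M : R) : 0 < e ->
  (forall i, A i -> 0 <= f i <= M) ->
  (forall i j, A i -> A j -> i != j -> f i + e <= f j \/ f j + e <= f i) ->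
  finite_set A.
Proof.
move=> e0 fM sep; pose h i := Num.truncn (f i / e).
have hE i : A i -> (h i)%:R <= f i / e < (h i).+1%:R.
  by move=> /fM/andP[f0 _]; rewrite truncn_itv// divr_ge0// ltW.
have hinj : {in A &, injective h}.
  move=> i j /[!inE] Ai Aj hij; apply/eqP/negPn/negP => ij.
  have /andP[] := hE i Ai; have /andP[] := hE j Aj.
  rewrite hij !ler_pdivlMr// !ltr_pdivrMr// -natr1 mulrDl mul1r.
  by have [] := sep i j Ai Aj ij; lra.
rewrite -(eq_finite_set (inj_card_eq hinj)).
apply: sub_finite_set (finite_II (Num.truncn (M / e)).+1) => _ [i Ai <-] /=.
rewrite ltnS; apply: le_truncn; rewrite ler_pM2r ?invr_gt0//.
by have /andP[] := fM i Ai.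
Qed.

(* The bumps [phi i] need not be locally finite; their increments [del i] along
   a well-order of the indices are, once small values are cut off: the bumps
   with large increments at a point take values that are pairwise far apart. *)
Lemma metric_locally_finite_bumps (eps : T -> R) :
  (forall i, 0 <= eps i <= 1) ->
  exists e : T -> T -> R,
  [/\ forall i, continuous (e i),
      forall i x, 0 <= e i x,
      forall i x, 0 < e i x -> mdist i x < eps i &
      forall x, 0 < eps x -> (exists i, 0 < e i x) /\
        exists2 J : set T, finite_set J &
          \forall z \near x, forall i, 0 < e i z -> J i].
Proof.
move=> eps01; have [lt [lt_total lt_wf]] := well_founded_total_rel T.
pose phi i x := Num.max 0 (eps i - mdist i x).
have phi_ge0 i x : 0 <= phi i x by rewrite le_max lexx.
have phi_le1 i x : phi i x <= 1.
  rewrite ge_max ler01 lerBlDr; have /andP[_ /le_trans->//] := eps01 i.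
  by rewrite lerDl mdist_ge0.
have phi_lip i : lipschitz_fun 1 (phi i).
  apply: lipschitz_max0 => // x z.
  rewrite mul1r; have := metric_triangle i x z; lra.
pose tau i x := sup [set phi j x | j in [set j | lt j i]].
have tau_ub i j x : lt j i -> phi j x <= tau i x.
  by move=> ji; apply: ub_le_sup; [exists 1 => _ [k _ <-]|exists j].
have tau_ge0 i x : 0 <= tau i x.
  have [ji|/set0P[j ji]] := eqVneq [set j | lt j i] set0.
    by rewrite /tau ji image_set0 sup0.
  by rewrite (le_trans (phi_ge0 j x))// tau_ub.
have tau_lip i : lipschitz_fun 1 (tau i) by exact: lipschitz_sup.
pose del i x := Num.max 0 (phi i x - tau i x).
have del_le1 i x : del i x <= 1.
  by rewrite ge_max ler01; have := phi_le1 i x; have := tau_ge0 i x; lra.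
have del_lip i : lipschitz_fun 2 (del i).
  apply: lipschitz_max0 => // x z.
  by have := phi_lip i x z; have := tau_lip i z x; rewrite (metric_sym z); lra.
pose m x := sup [set del i x | i in setT].
have m_ub i x : del i x <= m x.
  by apply: ub_le_sup; [exists 1 => _ [k _ <-]|exists i].
have m_ge0 x : 0 <= m x by rewrite (le_trans _ (m_ub x x))// le_max lexx.
have m_lip : lipschitz_fun 2 m by exact: lipschitz_sup.
(* At the least index whose bump is positive at [x], all earlier bumps vanish, so the increment is
   the whole bump. *)
have m_gt0 x : 0 < eps x -> 0 < m x.
  move=> ex; have [|i /= phii lti] := lt_wf [set i | 0 < phi i x].
    by exists x; rewrite /= /phi mdistxx subr0 lt_max ex orbT.
  apply: lt_le_trans (m_ub i x); rewrite lt_max ltxx /= subr_gt0.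
  apply: le_lt_trans phii.
  have [ji|/set0P[j ji]] := eqVneq [set j | lt j i] set0.
    by rewrite /tau ji image_set0 sup0.
  apply: ge_sup; first by exists (phi j x), j.
  by move=> _ [k /lti /= /negP phik <-]; rewrite leNgt.
(* Only increments above half of their supremum [m x] survive; where [m x] is positive, at least one
   does. *)
exists (fun i x => Num.max 0 (del i x - m x / 2)); split.
- move=> i; apply: (@lipschitz_fun_continuous 3) => //.
  apply: lipschitz_max0 => // x z.
  by have := del_lip i x z; have := m_lip z x; rewrite (metric_sym z); lra.
- by move=> i x; rewrite le_max lexx.
- move=> i x; rewrite lt_max ltxx /= subr_gt0 => dm.
  have : 0 < del i x by apply: le_lt_trans dm; rewrite divr_ge0.
  rewrite lt_max ltxx /= subr_gt0 => tp.
  have : 0 < phi i x by apply: le_lt_trans tp.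
  by rewrite lt_max ltxx /= subr_gt0.
move=> x ex; have mx := m_gt0 _ ex; split.
  have [||_ [i _ <-] xi] := @sup_gt _ [set del i x | i in setT] (m x / 2).
  - by exists (del x x), x.
  - by rewrite -/(m x); lra.
  by exists i; rewrite lt_max ltxx /= subr_gt0.
(* Within [m x / 16] of [x], the 2-Lipschitz functions [del i] and [m] vary by at most [m x / 8], so
   an increment above [m z / 2] at [z] exceeds [5 m x / 16] at [x]. *)
exists [set i | m x / 8 <= del i x].
  apply: (@finite_separated _ (phi^~ x) (m x / 8) 1).
  - by rewrite divr_gt0.
  - by move=> i _; rewrite phi_ge0 phi_le1.
  have sep i j : m x / 8 <= del j x -> lt i j -> phi i x + m x / 8 <= phi j x.
    move=> + /(tau_ub _ _ x) tp; rewrite le_max => /orP[|]; lra.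
  by move=> i j /= di dj /lt_total[|] ij; [left|right]; exact: sep.
apply/metricType_numDomainType.nbhs_mdistP.
exists (m x / 16) => /=; first by rewrite divr_gt0.
move=> z /= xz i; rewrite lt_max ltxx /= => dm.
by have := del_lip i z x; have := m_lip x z; rewrite (metric_sym z); lra.
Qed.

End metric_partition.

Lemma convex_setP (R : realType) (E : lmodType R) (A : set E) :
  convex_set A <->
  (forall x y (t : R), A x -> A y -> 0 <= t <= 1 -> A (t *: x + (1 - t) *: y)).
Proof.
split=> [cA x y t Ax Ay t01|cA x y l /set_mem Ax /set_mem Ay].
  have := cA x y (Itv01 (proj1 (andP t01)) (proj2 (andP t01))).
  by move=> /(_ (mem_set Ax) (mem_set Ay)) /set_mem.
by apply/mem_set/cA => //; apply/andP; split.
Qed.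

(** Induction on the list, each partial sum being divided by its total weight; strict positivity of
    the weights keeps that total nonzero. *)
Lemma convex_set_sum (R : realType) (E : lmodType R) (A : set E) (I : eqType)
    (s : seq I) (w : I -> R) (y : I -> E) :
  convex_set A -> (forall i, i \in s -> 0 < w i) ->
  \sum_(i <- s) w i = 1 -> (forall i, i \in s -> A (y i)) ->
  A (\sum_(i <- s) w i *: y i).
Proof.
move=> /convex_setP cA w0 w1 Ay.
suff H : forall s', s' != [::] -> {subset s' <= s} ->
    A ((\sum_(i <- s') w i)^-1 *: \sum_(i <- s') w i *: y i).
  have := H s; rewrite w1 invr1 scale1r; apply=> //.
  by apply/eqP => s0; move: w1; rewrite s0 big_nil => /eqP; rewrite eq_sym oner_eq0.
elim=> // i s' IH _ ss'.
have is' : i \in s by apply: ss'; rewrite mem_head.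
have wi := w0 i is'.
have [->|s'0] := eqVneq s' [::].
  by rewrite !big_seq1 scalerA mulVf ?scale1r ?gt_eqF//; exact: Ay.
have {}ss' : {subset s' <= s} by move=> j js; apply: ss'; rewrite in_cons js orbT.
have := cA (y i) _ (w i / \sum_(j <- i :: s') w j) (Ay _ is') (IH s'0 ss').
rewrite !big_cons.
set W := \sum_(j <- s') w j.
have W0 : 0 < W.
  rewrite /W; case: s' s'0 ss' {IH W} => // j s' _ ss'.
  rewrite big_cons ltr_pwDl ?w0 ?ss' ?mem_head// big_seq sumr_ge0// => k ks.
  by rewrite ltW// w0// ss'// in_cons ks orbT.
have wW : w i + W != 0 by rewrite gt_eqF// addr_gt0.
have -> : 1 - w i / (w i + W) = W / (w i + W).
  by rewrite -{1}(divff wW) -mulrBl addrAC subrr add0r.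
rewrite scalerA mulrAC divff ?gt_eqF// mul1r mulrC -scalerA -scalerDr.
apply; apply/andP; split; first by rewrite mulr_ge0// ?invr_ge0 ?addr_ge0// ltW.
by rewrite ler_pdivrMl ?addr_gt0// mulr1 lerDl ltW.
Qed.

Lemma cvg_sum_seq (R : realType) (E : normedModType R) (T : Type)
    (F : set_system T) (FF : Filter F) (I : Type) (s : seq I)
    (f : I -> T -> E) (l : I -> E) :
  (forall i, f i x @[x --> F] --> l i) ->
  (\sum_(i <- s) f i x) @[x --> F] --> \sum_(i <- s) l i.
Proof.
move=> fl; elim: s => [|i s IH].
  by under eq_cvg do rewrite big_nil; rewrite big_nil; exact: cvg_cst.
by under eq_cvg do rewrite big_cons; rewrite big_cons; exact: cvgD.
Qed.

(** The constants [y i] are averaged with the normalised bumps. The radius [eps i] says how far from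
    [i] the constant [y i] may be used; radius 0 excludes [i], which allows for data given only on a
    subset. *)
Lemma convex_patching (R : realType) (T : metricType R) (E : normedModType R)
    (eps : T -> R) (y : T -> E) :
  (forall i, 0 <= eps i <= 1) ->
  exists f : T -> E, forall x, 0 < eps x ->
    {for x, continuous f} /\
    exists (s : seq T) (w : T -> R),
      [/\ forall i, i \in s -> 0 < w i /\ mdist i x < eps i,
          \sum_(i <- s) w i = 1 & f x = \sum_(i <- s) w i *: y i].
Proof.
move=> eps01.
have [e [e_cont e_ge0 e_supp e_fin]] := metric_locally_finite_bumps eps01.
pose S x := [set i | 0 < e i x].
pose tot x := \sum_(i \in S x) e i x.
pose num x : E := \sum_(i \in S x) e i x *: y i.
exists (fun x => (tot x)^-1 *: num x) => x ex.
have [[i0 i0x] [J finJ nearJ]] := e_fin x ex.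
have enot i z : ~ S z i -> e i z = 0.
  by move=> /negP; rewrite -leNgt => ez; apply/eqP; rewrite eq_le ez e_ge0.
have totE z : S z `<=` J -> tot z = \sum_(i <- fset_set J) e i z.
  move=> SJ; rewrite /tot (fsbig_widen _ J)//; first by rewrite fsbig_finite.
  by move=> i [_ /enot].
have numE z : S z `<=` J -> num z = \sum_(i <- fset_set J) e i z *: y i.
  move=> SJ; rewrite /num (fsbig_widen _ J)//; first by rewrite fsbig_finite.
  by move=> i [_ /enot /= ->]; rewrite scale0r.
have SxJ : S x `<=` J by move=> i; exact: (nbhs_singleton nearJ).
have finS : finite_set (S x) by exact: sub_finite_set finJ.
have tot_gt0 : 0 < tot x.
  rewrite /tot fsbig_finite//= (big_rem i0) /=; last first.
    by rewrite in_fset_set//; exact: mem_set.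
  by rewrite ltr_pwDl// sumr_ge0.
split.
  have totc : tot z @[z --> x] --> tot x.
    rewrite totE//; apply: cvg_trans; last first.
      apply: (@cvg_sum_seq _ R^o _ (nbhs x) _ _ (fset_set J) (fun i z => e i z)) => i.
      exact: e_cont.
    by apply: near_eq_cvg; near do rewrite totE//; exact: nearJ.
  have numc : num z @[z --> x] --> num x.
    rewrite numE//; apply: cvg_trans; last first.
      apply: (@cvg_sum_seq _ E _ (nbhs x) _ _ (fset_set J)
        (fun i z => e i z *: y i)) => i.
      by apply: cvgZr_tmp; exact: e_cont.
    by apply: near_eq_cvg; near do rewrite numE//; exact: nearJ.
  by apply: cvgZ => //; apply: cvgV => //; rewrite gt_eqF.
exists (fset_set (S x)), (fun i => e i x / tot x); split.
- move=> i; rewrite in_fset_set// => /set_mem Si; split; last exact: e_supp.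
  by rewrite divr_gt0.
- by rewrite -mulr_suml -fsbig_finite// divff// gt_eqF.
- rewrite /num fsbig_finite// scaler_sumr; apply: eq_bigr => i _.
  by rewrite scalerA mulrC.
Unshelve. all: by end_near. Qed.

(** * Selections of paraconvex-valued maps *)

Lemma convex_hull_convex (R : realType) (E : normedModType R) (A : set E) :
  convex_set (convex_hull A).
Proof.
apply/convex_setP => x y t Ax Ay t01 M [cM AM].
by move/convex_setP : (cM); apply=> //; [exact: Ax|exact: Ay].
Qed.

Lemma ball_convex (R : realType) (E : normedModType R) (c : E) (r : R) :
  convex_set (ball c r).
Proof.
apply/convex_setP => x y t; rewrite -!ball_normE /= => cx cy /andP[t0 t1].
have -> : c - (t *: x + (1 - t) *: y) = t *: (c - x) + (1 - t) *: (c - y).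
  by rewrite !scalerBr addrACA -scalerDl [t + _]addrC subrK scale1r opprD.
apply: le_lt_trans (ler_normD _ _) _; rewrite !normrZ ger0_norm// ger0_norm ?subr_ge0//.
have [->|tn0] := eqVneq t 0; first by rewrite mul0r add0r subr0 mul1r.
have -> : r = t * r + (1 - t) * r by rewrite -mulrDl [t + _]addrC subrK mul1r.
apply: ltr_leD; first by rewrite ltr_pM2l// lt_neqAle eq_sym tn0.
by rewrite ler_wpM2l ?subr_ge0// ltW.
Qed.

Lemma geometric_cauchy_limit (R : realType) (E : completeNormedModType R)
    (u : nat -> E) (c k : R) : 0 <= c -> 0 <= k < 1 ->
  (forall n, `|u n.+1 - u n| <= c * k ^+ n) ->
  exists l : E, forall n, `|l - u n| <= c * k ^+ n / (1 - k).
Proof.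
move=> c0 /andP[k0 k1] uk.
have cu : cvgn u.
  have : cvgn (series (telescope u)).
    apply: normed_cvg; apply: series_le_cvg.
    - by move=> n; exact: normr_ge0.
    - by move=> n; apply: (geometric_ge0 n c0 k0).
    - by move=> n; exact: uk.
    - by apply: is_cvg_geometric_series; rewrite ger0_norm.
  rewrite telescopeK => /cvg_ex[/= l ul]; apply/cvg_ex; exists (l + u 0%N).
  have : (fun n => (u n - u 0%N) + u 0%N) @ \oo --> l + u 0%N.
    by apply: cvgD => //; exact: cvg_cst.
  by under eq_fun do rewrite subrK.
exists (limn u) => n.
have bound m : `|u (m + n)%N - u n| <= c * k ^+ n * (1 - k ^+ m) / (1 - k).
  elim: m => [|m IH]; first by rewrite add0n subrr normr0 expr0 subrr mulr0 mul0r.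
  rewrite (le_trans (ler_distD (u (m + n)%N) _ _))// addSn.
  rewrite (le_trans (lerD (uk _) IH))// ler_pdivlMr ?subr_gt0// mulrDl.
  rewrite divfK ?gt_eqF ?subr_gt0// exprS exprD.
  by rewrite le_eqVlt; apply/orP; left; apply/eqP; ring.
have c1 : `|u m - u n| @[m --> \oo] --> `|limn u - u n|.
  by apply: cvg_norm; apply: cvgB => //; exact: cvg_cst.
apply: cvgr_to_le c1 _; exists n => // m /= nm.
rewrite -(subnK nm) (le_trans (bound _))// ler_wpM2r ?invr_ge0 ?subr_ge0 ?(ltW k1)//.
by rewrite ler_piMr ?mulr_ge0 ?exprn_ge0// lerBlDr lerDl exprn_ge0.
Qed.

Section paraconvex_selection.
Context (R : realType) (T : metricType R) (D : set T) (beta gamma : R).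
Hypothesis openD : open D.
Hypotheses (beta_ge0 : 0 <= beta) (beta_gamma : beta < gamma).

Section step.
Context (E : normedModType R) (Phi : T -> set E).

Definition lsc_on := forall x y e, D x -> Phi x y -> 0 < e ->
  \forall z \near x, exists2 y', Phi z y' & `|y' - y| < e.

(** The bound is strict and comes with a witness; an [alpha]-paraconvex value satisfies it for every
    [beta > alpha], by [paraconvex_lt]. *)
Definition paraconvex_valued := forall x c r q, D x -> 0 < r ->
  convex_hull (Phi x `&` ball c r) q -> exists2 p, Phi x p & `|q - p| < beta * r.

Hypotheses (Phi_lsc : lsc_on) (Phi_pcvx : paraconvex_valued).

(** Locally constant approximate selections [y i] are patched into [f']. By lower semicontinuity
    each [y i] used at [x] is close to some [z i] in [Phi x]; the same average [q] of the [z i] is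
    close to [f' x], and paraconvexity brings [q] close to [Phi x]. *)
Lemma paraconvex_selection_step (rho : T -> R) (f : T -> E) :
  (forall x, D x -> [/\ {for x, continuous rho}, {for x, continuous f}, 0 < rho x &
    exists2 y, Phi x y & `|f x - y| < rho x]) ->
  exists f' : T -> E, forall x, D x ->
    [/\ {for x, continuous f'}, `|f' x - f x| <= rho x &
        exists2 y, Phi x y & `|f' x - y| < gamma * rho x].
Proof.
move=> H.
(* Solution of [kap + beta * (1 + kap) = gamma]: replacing the [y i] by the [z i] costs [kap], and
   paraconvexity is applied in a ball enlarged by the factor [1 + kap]. *)
pose kap := (gamma - beta) / (1 + beta).
have kap0 : 0 < kap by rewrite divr_gt0 ?subr_gt0 ?ltr_pwDl.
have kapE : gamma = kap + beta * (1 + kap).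
  rewrite mulrDr mulr1 addrCA -{1}[kap]mul1r -mulrDl mulrC.
  by rewrite divfK ?gt_eqF ?ltr_pwDl// addrC subrK.
have /choice[y Py] : forall x, exists y, D x -> Phi x y /\ `|f x - y| < rho x.
  move=> x; have [Dx|nDx] := pselect (D x); last by exists 0.
  by have [_ _ _ [y Py fy]] := H x Dx; exists y.
pose good x z := [/\ D z, `|f z - y x| < rho z &
  exists2 y', Phi z y' & `|y' - y x| < kap * rho z].
have /choice[eps Heps] : forall x, exists e : R, 0 <= e <= 1 /\
    (D x -> 0 < e /\ forall z, mdist x z < e -> good x z) /\ (~ D x -> e = 0).
  move=> x; have [Dx|nDx] := pselect (D x); last first.
    by exists 0; rewrite lexx ler01.
  have [cr cf r0 _] := H x Dx; have [Pyx fy] := Py x Dx.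
  have : \forall z \near x, good x z.
    have nD : \forall z \near x, D z by exact: open_nbhs_nbhs.
    have nlt : \forall z \near x, 0 < rho z - `|f z - y x|.
      have : (rho z - `|f z - y x|) @[z --> x] --> rho x - `|f x - y x|.
        by apply: cvgB => //; apply: cvg_norm; apply: cvgB => //; exact: cvg_cst.
      by move=> /cvgr_gt; apply; rewrite subr_gt0.
    have nrho : \forall z \near x, rho x / 2 < rho z.
      by move/cvgr_gt : cr; apply; rewrite ltr_pdivrMr// ltr_pMr// ltr1n.
    have nPhi := Phi_lsc Dx Pyx (mulr_gt0 kap0 (divr_gt0 r0 (ltr0Sn _ 1))).
    near=> z; split; [by near: z|by rewrite -subr_gt0; near: z|].
    have [//|y' Py' y'y] := near nPhi z.
    exists y' => //; apply: lt_trans y'y _.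
    by rewrite ltr_pM2l//; near: z.
  move/metricType_numDomainType.nbhs_mdistP => -[e /= e0 egood].
  exists (Num.min e 1); split; last split=> // _.
    by rewrite le_min ltW// ler01 ge_min lexx orbT.
  split; first by rewrite lt_min e0 ltr01.
  by move=> z; rewrite lt_min => /andP[ze _]; exact: egood.
have eps01 x : 0 <= eps x <= 1 by have [] := Heps x.
have [f' Hf'] := convex_patching y eps01.
exists f' => x Dx; have [eps0 _] := (Heps x).2.1 Dx.
have [cf' [s [w [ws w1 f'E]]]] := Hf' x eps0.
have [_ _ rho0 _] := H x Dx.
have w0 i : i \in s -> 0 < w i by move=> /ws[].
have sgood i : i \in s -> good i x.
  move=> /ws[_ ix]; have [_ [dD ndD]] := Heps i.
  have [Di|/ndD eps_i0] := pselect (D i); first exact: (dD Di).2.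
  by move: ix; rewrite eps_i0 ltNge mdist_ge0.
have /choice[z Hz] : forall i, exists z, i \in s -> Phi x z /\ `|z - y i| < kap * rho x.
  move=> i; have [/sgood[_ _ [z Pz zy]]|nis] := boolP (i \in s).
    by exists z.
  by exists 0.
split=> //.
  rewrite ltW// -normrN opprB.
  suff : ball (f x) (rho x) (f' x) by rewrite -ball_normE.
  rewrite f'E; apply: convex_set_sum => //; first exact: ball_convex.
  by move=> i /sgood[_ + _]; rewrite -ball_normE.
pose q := \sum_(i <- s) w i *: z i.
have : convex_hull (Phi x `&` ball (f x) ((1 + kap) * rho x)) q.
  apply: convex_set_sum => //; first exact: convex_hull_convex.
  move=> i is'; apply: sub_gen_smallest; have [Pz zy] := Hz i is'.
  split=> //; have [_ fy _] := sgood i is'; rewrite -ball_normE /=.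
  rewrite (le_lt_trans (ler_distD (y i) _ _))// mulrDl mul1r ltrD//.
  by rewrite distrC.
move=> /Phi_pcvx[//||p Pp qp]; first by rewrite mulr_gt0// ltr_pwDl// ltW.
exists p => //.
rewrite kapE mulrDl (le_lt_trans (ler_distD q _ _))// ltrD//; last first.
  by rewrite -mulrA.
have : ball 0 (kap * rho x) (f' x - q).
  rewrite f'E /q -sumrB; under eq_bigr do rewrite -scalerBr.
  apply: convex_set_sum => //; first exact: ball_convex.
  by move=> i /Hz[_]; rewrite -ball_normE /= sub0r opprB.
by rewrite -ball_normE /= sub0r normrN.
Unshelve. all: by end_near. Qed.

End step.

(** The step is iterated with errors [rho x * gamma ^+ n]; summing the geometric corrections gives
    the factor [1 / (1 - gamma)]. The limit lies in the closure of [Phi x], hence the form of the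
    last clause. *)
Lemma paraconvex_selection (E : completeNormedModType R) (Phi : T -> set E)
    (rho : T -> R) (f0 : T -> E) :
  gamma < 1 -> lsc_on Phi -> paraconvex_valued Phi ->
  (forall x, D x -> [/\ {for x, continuous rho}, {for x, continuous f0}, 0 < rho x &
    exists2 y, Phi x y & `|f0 x - y| < rho x]) ->
  exists g : T -> E, forall x, D x ->
    [/\ {for x, continuous g}, `|g x - f0 x| <= rho x / (1 - gamma) &
        forall e, 0 < e -> exists2 y, Phi x y & `|g x - y| < e].
Proof.
move=> gamma1 Phi_lsc Phi_pcvx H0.
have gamma0 : 0 < gamma by exact: le_lt_trans beta_gamma.
pose ok n (f : T -> E) := forall x, D x ->
  {for x, continuous f} /\ exists2 y, Phi x y & `|f x - y| < rho x * gamma ^+ n.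
have /choice[nxt Hnxt] : forall nf : nat * (T -> E), exists f' : T -> E,
    ok nf.1 nf.2 -> ok nf.1.+1 f' /\
      forall x, D x -> `|f' x - nf.2 x| <= rho x * gamma ^+ nf.1.
  move=> [n f] /=; have [okf|nok] := pselect (ok n f); last by exists f.
  have [|f' Hf'] := @paraconvex_selection_step _ _ Phi_lsc Phi_pcvx
    (fun x => rho x * gamma ^+ n) f.
    move=> x Dx; have [cr _ r0 _] := H0 x Dx; have [cf fy] := okf x Dx.
    by split=> //; [exact: cvgMr_tmp|rewrite mulr_gt0// exprn_gt0].
  exists f' => _; split=> [x Dx|x Dx]; have [cf' f'f yP] := Hf' x Dx => //.
  by split=> //; rewrite exprS mulrCA.
pose F := fix F n := if n is m.+1 then nxt (m, F m) else f0.
have Fok n : ok n (F n).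
  elim: n => [|n IH] /=; last by have [] := Hnxt (n, F n) IH.
  by move=> x Dx; have [_ cf _ yP] := H0 x Dx; split=> //; rewrite expr0 mulr1.
have Fs n x : D x -> `|F n.+1 x - F n x| <= rho x * gamma ^+ n.
  by move=> Dx; have [_] := Hnxt (n, F n) (Fok n); apply.
have /choice[g Hg] : forall x, exists l, D x ->
    forall n, `|l - F n x| <= rho x * gamma ^+ n / (1 - gamma).
  move=> x; have [Dx|nDx] := pselect (D x); last by exists 0.
  have [_ _ r0 _] := H0 x Dx.
  have [||n|l Hl] := @geometric_cauchy_limit _ E (F^~ x) (rho x) gamma.
  - exact: ltW.
  - by rewrite gamma1 ltW.
  - exact: Fs.
  by exists l.
have small a e : 0 < e -> exists n, a * gamma ^+ n / (1 - gamma) < e /\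
    a * gamma ^+ n < e.
  move=> e0.
  have c : (fun n => a * gamma ^+ n) @ \oo --> (0 : R).
    rewrite -[0](mulr0 a); apply: cvgMl_tmp; apply: cvg_expr.
    by rewrite gtr0_norm.
  have c' : (fun n => a * gamma ^+ n / (1 - gamma)) @ \oo --> (0 : R).
    by rewrite -[0](mul0r (1 - gamma)^-1); apply: cvgMr_tmp.
  have [n _ Hn] : \forall n \near \oo, a * gamma ^+ n / (1 - gamma) < e /\
      a * gamma ^+ n < e.
    near=> n; split; near: n; first exact: (cvgr_lt _ c').
    exact: (cvgr_lt _ c).
  by exists n; apply: Hn => /=.
exists g => x Dx; have [cr cf0 r0 _] := H0 x Dx; split.
- apply/cvgrPdist_lt => e e0.
  (* Since [rho] stays below [rho x + 1] near [x], a single [n] makes the tail small on a whole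
     neighbourhood. *)
  have [n [Hn _]] := small (rho x + 1) (e / 3) (divr_gt0 e0 (ltr0Sn _ 2)).
  have bound z : D z -> rho z < rho x + 1 -> `|g z - F n z| < e / 3.
    move=> Dz rz; apply: le_lt_trans (Hg z Dz n) _; apply: le_lt_trans Hn.
    rewrite ler_wpM2r ?invr_ge0 ?subr_ge0 ?(ltW gamma1)//.
    by rewrite ler_wpM2r ?exprn_ge0 ?ltW// ltW.
  have [cF _] := Fok n x Dx.
  have nD : \forall z \near x, D z by exact: open_nbhs_nbhs.
  have nr : \forall z \near x, rho z < rho x + 1.
    by apply: (cvgr_lt (rho x)) => //; rewrite ltrDl.
  have nF : \forall z \near x, `|F n x - F n z| < e / 3.
    by move/cvgrPdist_lt : cF; apply; rewrite divr_gt0.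
  near=> z.
  have bz : `|g z - F n z| < e / 3 by apply: bound; near: z.
  have bx : `|g x - F n x| < e / 3 by apply: bound => //; rewrite ltrDl.
  have Fz : `|F n x - F n z| < e / 3 by near: z.
  rewrite (le_lt_trans (ler_distD (F n x) _ _))//.
  have := ler_distD (F n z) (F n x) (g z); rewrite (distrC (F n z)); lra.
- by have := Hg x Dx 0%N; rewrite expr0 mulr1.
- move=> e e0; have [n [Hn Hn']] := small (rho x) (e / 2) (divr_gt0 e0 (ltr0Sn _ 1)).
  have [_ [y Py Fy]] := Fok n x Dx; exists y => //.
  by have := Hg x Dx n; have := ler_distD (F n x) (g x) y; lra.
Unshelve. all: by end_near. Qed.

End paraconvex_selection.

(** * Retractions close to a given map *)

Section normed_metric.
Context (R : realType) (V : normedModType R).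

Let dist (x y : V) : R := `|x - y|.

Let dist_ge0 x y : 0 <= dist x y. Proof. exact: normr_ge0. Qed.

Let dist_eq0 x y : dist x y = 0 -> x = y.
Proof. by move/normr0_eq0/subr0_eq. Qed.

Let ball_dist x d : ball x d = [set y | dist x y < d].
Proof. by rewrite -ball_normE. Qed.

(* Normed modules do not inherit from [metricType] in MathComp-Analysis. *)
Definition normed_metric : metricType R :=
  HB.pack_for (metricType R) V
    (PseudoMetric_isMetric.Build R V dist_ge0 dist_eq0 ball_dist).

End normed_metric.

Section dist_set.
Context (R : realType) (B : normedModType R).
Implicit Type P : set B.

Definition dist_set P (b : B) : R := inf [set `|b - p| | p in P].

Lemma dist_set_le P b p : P p -> dist_set P b <= `|b - p|.
Proof. by move=> Pp; apply: ge_inf; [exists 0 => _ [q _ <-]|exists p]. Qed.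

Lemma dist_set_ge0 P b : 0 <= dist_set P b.
Proof.
have [->|/set0P[p Pp]] := eqVneq P set0; first by rewrite /dist_set image_set0 inf0.
by apply: lb_le_inf => [|_ [q _ <-]//]; exists `|b - p|, p.
Qed.

Lemma dist_set_lt P b r : P !=set0 -> dist_set P b < r ->
  exists2 p, P p & `|b - p| < r.
Proof.
move=> [p Pp] /inf_lt[|_ [q Pq <-] qr]; first by exists `|b - p|, p.
by exists q.
Qed.

Lemma dist_set_lip P b c : P !=set0 -> dist_set P b <= dist_set P c + `|b - c|.
Proof.
move=> P0; apply/ler_addgt0Pr => e e0.
have [|p Pp cp] := @dist_set_lt P c (dist_set P c + e) P0; first by rewrite ltrDl.
have := dist_set_le b Pp; have := ler_distD c b p; lra.
Qed.

Lemma dist_set_continuous P : P !=set0 -> continuous (dist_set P).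
Proof.
move=> P0 b; apply/cvgrPdist_lt => e e0.
apply: filterS (nbhsx_ballx b e e0) => c; rewrite -ball_normE /= => bc.
have := dist_set_lip b c P0; have := dist_set_lip c b P0.
by rewrite (distrC c) ltr_norml; lra.
Qed.

Lemma dist_set0 P b : P b -> dist_set P b = 0.
Proof.
move=> Pb; apply/eqP; rewrite eq_le dist_set_ge0 andbT.
by rewrite (le_trans (dist_set_le b Pb))// subrr normr0.
Qed.

Lemma closed_approx P b : closed P ->
  (forall e, 0 < e -> exists2 p, P p & `|b - p| < e) -> P b.
Proof.
move=> cP H; apply: cP => A; rewrite -nbhs_ballE => -[e /= e0 eA].
have [p Pp bp] := H e e0; exists p; split=> //; apply: eA.
by rewrite -ball_normE.
Qed.

Lemma dist_set_gt0 P b : P !=set0 -> closed P -> ~ P b -> 0 < dist_set P b.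
Proof.
move=> P0 cP nPb; rewrite lt_neqAle dist_set_ge0 andbT eq_sym.
apply/eqP => d0; apply: nPb; apply: closed_approx => // e e0.
by apply: dist_set_lt => //; rewrite d0.
Qed.

Lemma paraconvex_lt (alpha gamma : R) P r c q : paraconvex alpha P ->
  alpha < gamma -> 0 < r -> convex_hull (P `&` ball c r) q ->
  exists2 p, P p & `|q - p| < gamma * r.
Proof.
move=> [_ _ pP] ag r0 /(pP _ _ _ r0) d.
have : (edist_inf P q < (gamma * r)%:E)%E.
  by apply: le_lt_trans d _; rewrite lte_fin ltr_pM2r.
move=> /ereal_inf_lt[_ [p Pp <-]] /edist_lt_ball /=.
by rewrite -ball_normE /=; exists p.
Qed.

End dist_set.

Section retraction_near.
Context (R : realType) (B : completeNormedModType R) (alpha gamma : R) (P : set B).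
Hypotheses (alpha_ge0 : 0 <= alpha) (alpha_gamma : alpha < gamma) (gamma1 : gamma < 1).
Hypothesis pP : paraconvex alpha P.

(** Off [P], the selection theorem with constant value [P] corrects [f] by at most
    [rho / (1 - gamma)]; on [P] the identity is used. The two pieces fit continuously because [rho]
    vanishes on [P], where [f] is the identity. *)
Lemma paraconvex_extension (f : B -> B) (rho : B -> R) :
  continuous f -> continuous rho ->
  (forall p, P p -> f p = p /\ rho p = 0) ->
  (forall b, ~ P b -> 0 < rho b /\ exists2 p, P p & `|f b - p| < rho b) ->
  exists g : B -> B, [/\ continuous g, forall b, P (g b) &
    forall b, `|g b - f b| <= rho b / (1 - gamma)].
Proof.
move=> cf cr fP rhoP; have [P0 cP _] := pP.
move: alpha_ge0 alpha_gamma => a0 ag.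
have [||||||g Hg] := @paraconvex_selection R (normed_metric B) (~` P)
    ((alpha + gamma) / 2) gamma _ _ _ B (fun=> P) rho f gamma1.
- exact: closed_openC.
- by lra.
- by lra.
- by move=> x y e _ Py e0; apply: nearW => z; exists y; rewrite ?subrr ?normr0.
- move=> x c r q _ r0; apply: paraconvex_lt pP _ r0; lra.
- by move=> x nPx; have [r0 fr] := rhoP x nPx; split=> //; [exact: cr|exact: cf].
pose h b := if pselect (P b) then b else g b.
have hin b : P b -> h b = b by rewrite /h; case: pselect.
have hout b : ~ P b -> h b = g b by rewrite /h; case: pselect.
have hP b : P (h b).
  have [Pb|nPb] := pselect (P b); first by rewrite hin.
  by rewrite hout//; have [_ _] := Hg b nPb; exact: closed_approx.
have hf b : `|h b - f b| <= rho b / (1 - gamma).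
  have [Pb|nPb] := pselect (P b); last by rewrite hout//; have [] := Hg b nPb.
  by have [fb rb] := fP b Pb; rewrite hin// fb rb subrr normr0 mul0r.
exists h; split=> // b; have [Pb|nPb] := pselect (P b); last first.
  have [cg _ _] := Hg b nPb; rewrite /continuous_at hout//.
  apply: cvg_trans cg; apply: near_eq_cvg.
  have nD : \forall z \near b, (~` P) z.
    by apply: open_nbhs_nbhs; split=> //; exact: closed_openC.
  by apply: filterS nD => z nPz; rewrite hout.
have [fb rb] := fP b Pb.
rewrite /continuous_at hin//; apply/cvgrPdist_lt => e e0.
have nf : \forall z \near b, `|b - f z| < e / 2.
  by move/cvgrPdist_lt : (cf b); rewrite fb; apply; rewrite divr_gt0.
have nr : \forall z \near b, rho z < e / 2 * (1 - gamma).
  by apply: (cvgr_lt (rho b)); [exact: cr|rewrite rb mulr_gt0 ?divr_gt0 ?subr_gt0].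
near=> z.
have f_z : `|b - f z| < e / 2 by near: z.
have r_z : rho z / (1 - gamma) < e / 2 by rewrite ltr_pdivrMr ?subr_gt0//; near: z.
by have := hf z; have := ler_distD (f z) b (h z); rewrite (distrC (f z)); lra.
Unshelve. all: by end_near. Qed.

(** The radius [d] is the same for all points of [Q]; this uniformity is what survives a small
    Hausdorff perturbation of the set. *)
Definition near_id (Q : set B) (f : B -> B) := forall e, 0 < e ->
  exists2 d, 0 < d & forall p b, Q p -> `|b - p| < d -> `|f b - b| < e.

Lemma near_id_fix (Q : set B) (f : B -> B) p : near_id Q f -> Q p -> f p = p.
Proof.
move=> fid Qp; apply/eqP; rewrite -subr_eq0 -normr_le0; apply/ler_addgt0Pl => e e0.
by have [d d0 /(_ p p Qp)] := fid e e0; rewrite subrr normr0 addr0 => /(_ d0)/ltW.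
Qed.

(** That points of [Q] are fixed is contained in [near_id], by [near_id_fix]. *)
Definition uniform_retraction (Q : set B) (f : B -> B) :=
  (forall b, Q (f b)) /\ near_id Q f.

(** The tolerance [c] is cut down to a [rho] that tends to 0 uniformly near [P], so that the
    correction of [f] preserves [near_id]. The summand [dist_set P b] keeps [rho] positive off
    [P]. *)
Lemma uniform_retraction_near (f : B -> B) (c : B -> R) :
  continuous f -> near_id P f -> continuous c ->
  (forall b, exists2 p, P p & `|f b - p| < c b) ->
  exists g : B -> B, [/\ continuous g, uniform_retraction P g &
    forall b, `|g b - f b| <= c b / (1 - gamma)].
Proof.
move=> cf fid cc fc; have [P0 cP _] := pP.
have g1 : 0 < 1 - gamma by rewrite subr_gt0.
pose rho b := Num.min (c b) (dist_set P (f b) + dist_set P b).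
have [|||g [cg gP gf]] := @paraconvex_extension f rho cf.
- move=> b; apply: (@continuous_min R B c) => //; first exact: cc.
  apply: cvgD; last exact: dist_set_continuous.
  apply: (@continuous_comp _ _ _ f (dist_set P)); first exact: cf.
  exact: dist_set_continuous.
- move=> p Pp; have fp := near_id_fix fid Pp; split=> //.
  rewrite /rho fp dist_set0// addr0 min_r//.
  by have [q _ /ltW] := fc p; apply: le_trans.
- move=> b nPb; have db := dist_set_gt0 P0 cP nPb.
  have [p Pp pc] := fc b; split.
    rewrite lt_min (le_lt_trans _ pc)//=.
    by have := dist_set_ge0 P (f b); lra.
  have [q Pq qr] : exists2 q, P q & `|f b - q| < dist_set P (f b) + dist_set P b.
    by apply: dist_set_lt => //; rewrite ltrDl.
  have [cd|dc] := leP (c b) (dist_set P (f b) + dist_set P b).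
    by exists p => //; rewrite /rho min_l.
  by exists q => //; rewrite /rho min_r// ltW.
exists g; split=> //; last first.
  by move=> b; rewrite (le_trans (gf b))// ler_pM2r ?invr_gt0// ge_min lexx.
split=> // e e0.
(* With tolerance [e / k / 3] for [f] and for the distance to [P], [rho b] is at most [e / k]; the
   displacement of [f] and the correction then add up to less than [e]. *)
pose k := 1 + (1 - gamma)^-1.
have k1 : 1 < k by rewrite ltrDl invr_gt0.
have k0 : 0 < k by lra.
have e' : 0 < e / k / 3 by rewrite !divr_gt0.
have [d d0 Hd] := fid _ e'.
exists (Num.min d (e / k / 3)); first by rewrite lt_min d0.
move=> p b Pp; rewrite lt_min => /andP[bd be].
have fb := Hd p b Pp bd.
have db := le_lt_trans (dist_set_le b Pp) be.
have dfb := dist_set_lip (f b) b P0.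
have rb : rho b <= e / k / 3 + 2 * (e / k / 3).
  by rewrite (@le_trans _ _ (dist_set P (f b) + dist_set P b))//;
    [rewrite ge_min lexx orbT|lra].
apply: le_lt_trans (ler_distD (f b) _ _) _.
have rg : rho b / (1 - gamma) <= (e / k) / (1 - gamma).
  by rewrite ler_pM2r ?invr_gt0//; lra.
have ek : e / k + e / k / (1 - gamma) = e.
  by rewrite -[X in X + _]mulr1 -mulrDr -/k divfK// gt_eqF.
have := gf b.
have : 0 < e / k by rewrite divr_gt0.
lra.
Qed.

End retraction_near.

(** * Retractions as points of C_b(B, B) *)

Section Cb_norm.
Context (R : realType) (T : topologicalType) (V : normedModType R).
Implicit Types f g : Cb T V.

Lemma Cb_dist_ge f g x : `|f x - g x| <= `|f - g|.
Proof. exact: (ler_Cb_norm (f - g) x). Qed.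

Lemma Cb_dist_le f g (M : R) : 0 <= M -> (forall x, `|f x - g x| <= M) ->
  `|f - g| <= M.
Proof.
move=> M0 fgM; rewrite [leLHS]/(Cb_norm _).
have [->|/set0P ne] := eqVneq [set `|(f - g) x| | x in setT] set0.
  by rewrite sup0.
by apply: ge_sup => // _ [x _ <-]; exact: fgM.
Qed.

Definition Cb_of (f : T -> V) (cf : continuous f) (bf : bounded_fun f) : Cb T V :=
  MkCb (mem_set (conj cf bf)).

End Cb_norm.

Section Cb_complete.
Context (R : realType) (T : topologicalType) (V : completeNormedModType R).

(** Pointwise limits exist in [V]; passing to the limit in one argument of the Cauchy estimate makes
    the convergence uniform, and so continuity and boundedness are inherited. *)
Lemma Cb_cauchy_cvg (F : set_system (Cb T V)) : ProperFilter F -> cauchy F -> cvg F.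
Proof.
move=> FF /cauchyP Fc.
have Fdiam e : 0 < e -> exists f : Cb T V, \forall g \near F, `|f - g| < e.
  by move=> e0; have [f Ff] := Fc e e0; exists f; rewrite -ball_normE in Ff.
have Fx x : cvg ((fun f : Cb T V => f x) @ F).
  apply: cauchy_cvg; apply/cauchyP => e e0; have [f Ff] := Fdiam e e0.
  exists (f x); apply: filterS Ff => g fg; rewrite -ball_normE /=.
  exact: le_lt_trans (Cb_dist_ge f g x) fg.
pose l x := lim ((fun f : Cb T V => f x) @ F).
have lF e : 0 < e -> \forall f \near F, forall x : T, `|(f : Cb T V) x - l x| <= e.
  move=> e0; have [f Ff] := Fdiam (e / 2) (divr_gt0 e0 (ltr0Sn _ 1)).
  apply: filterS (Ff) => g fg x.
  have gl : `|g x - h x| @[h --> F] --> `|g x - l x|.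
    by apply: cvg_norm; apply: cvgB; [exact: cvg_cst|exact: Fx].
  apply: cvgr_to_le gl _; apply: filterS (Ff) => h fh.
  have := ler_distD (f x) (g x) (h x); rewrite (distrC (g x) (f x)).
  by have := Cb_dist_ge f g x; have := Cb_dist_ge f h x; lra.
have cl : continuous l.
  move=> x; apply/cvgrPdist_lt => e e0.
  have [f fl] := filter_ex (lF (e / 3) (divr_gt0 e0 (ltr0Sn _ 2))).
  have [cf _] := CbP f.
  have : \forall z \near x, `|f x - f z| < e / 3.
    by move/cvgrPdist_lt : (cf x); apply; rewrite divr_gt0.
  apply: filterS => z fz.
  have := fl x; have := fl z; have := ler_distD (f x) (l x) (l z).
  by have := ler_distD (f z) (f x) (l z); rewrite (distrC (l x) (f x)); lra.
have bl : bounded_fun l.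
  have [f fl] := filter_ex (lF 1 ltr01).
  exists (`|f| + 1); split=> [|K fK x _ /=]; first exact: num_real.
  have := fl x; have := ler_Cb_norm f x.
  have := ler_normB (f x) (f x - l x); rewrite subKr.
  by move: fK => /=; change `|f| with (Cb_norm f); lra.
apply/cvg_ex; exists (Cb_of cl bl); apply/cvgrPdist_le => e e0.
apply: filterS (lF e e0) => f fl; apply: Cb_dist_le => [|x]; first exact: ltW.
by rewrite distrC; exact: fl.
Qed.

HB.instance Definition _ := Uniform_isComplete.Build (Cb T V) Cb_cauchy_cvg.

End Cb_complete.

Section bexp_lemmas.
Context (R : realType) (B : normedModType R) (alpha : R).
Implicit Types P Q : bexp B alpha.

Lemma bexp_ball P Q d : ball P d Q ->
  forall p, bexp_set P p -> exists2 q, bexp_set Q q & `|q - p| < d.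
Proof.
rewrite ballEmdist /= => PQ p Pp.
have /inf_lt[|e [_ + _] ed] : hausdorff_dist P Q < d := PQ.
  have [[p0 Pp0] _ _] := bexp_paraconvex P.
  have [[q0 Qq0] _ _] := bexp_paraconvex Q.
  have /ex_strict_bound_gt0[M M0 PM] := bexp_bounded P.
  have /ex_strict_bound_gt0[N N0 QN] := bexp_bounded Q.
  (* The infimum defining the distance runs over a nonempty set, so some admissible radius lies
     below [d]. *)
  exists (M + N); split; first exact: addr_gt0.
    move=> x /PM /= xM; exists q0 => //; have /= := QN _ Qq0.
    by rewrite -ball_normE /=; have := ler_normB q0 x; lra.
  move=> x /QN /= xN; exists p0 => //; have /= := PM _ Pp0.
  by rewrite -ball_normE /=; have := ler_normB p0 x; lra.
move=> /(_ p Pp)[q Qq]; rewrite -ball_normE /= => qp.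
by exists q => //; exact: lt_trans ed.
Qed.

End bexp_lemmas.

(** * Paraconvexity and lower semicontinuity of the sets of retractions *)

Section uniform_retractions_paraconvex.
Context (R : realType) (B : completeNormedModType R) (alpha gamma : R).
Hypotheses (alpha_ge0 : 0 <= alpha) (alpha_gamma : alpha < gamma) (gamma1 : gamma < 1).
Implicit Types P Q : bexp B alpha.

Definition uniform_retractions P : set (Cb B B) :=
  [set f : Cb B B | uniform_retraction P f].

(** The retraction is bounded because [P] is. The given [f] may be unbounded, so that the identity
    can serve as a starting map. *)
Lemma uniform_retractions_near P (f : B -> B) (c : B -> R) :
  continuous f -> near_id P f -> continuous c ->
  (forall b, exists2 p, bexp_set P p & `|f b - p| < c b) ->
  exists2 g : Cb B B, uniform_retractions P g &
    forall b, `|g b - f b| <= c b / (1 - gamma).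
Proof.
move=> cf fid cc fc.
have [g [cg gP gf]] := uniform_retraction_near alpha_ge0 alpha_gamma gamma1
  (bexp_paraconvex P) cf fid cc fc.
have bg : bounded_fun g.
  have [M [Mr PM]] := bexp_bounded P; exists M; split=> // K MK b _.
  by apply: PM MK _ _; exact: gP.1.
by exists (Cb_of cg bg).
Qed.

Lemma uniform_retractions_nonempty P : uniform_retractions P !=set0.
Proof.
have [P0 _ _] := bexp_paraconvex P.
have [||||g gP _] := @uniform_retractions_near P id (fun b => dist_set P b + 1).
- by move=> b; exact: cvg_id.
- by move=> e e0; exists 1 => // p b _ _; rewrite subrr normr0.
- by move=> b; apply: cvgD; [exact: dist_set_continuous|exact: cvg_cst].
- by move=> b; apply: dist_set_lt => //; rewrite ltrDl.
by exists g.
Qed.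

Lemma near_id_convex P : convex_set [set f : Cb B B | near_id P f].
Proof.
apply/convex_setP => f g t fid gid t01 e e0.
have [d d0 fd] := fid e e0; have [d' d'0 gd] := gid e e0.
exists (Num.min d d'); first by rewrite lt_min d0.
move=> p b Pp; rewrite lt_min => /andP[bd bd'].
suff : ball b e ((t *: f + (1 - t) *: g) b) by rewrite -ball_normE /= distrC.
have /convex_setP cb := @ball_convex R B b e.
by apply: cb => //; rewrite -ball_normE /= distrC; [exact: fd bd|exact: gd bd'].
Qed.

(** Evaluation at [b] sends [q] into the hull of [P] intersected with a ball of radius [r], so [q b]
    is within [gamma * r] of [P]. As [near_id] is a convex condition, [q] can be corrected to a
    retraction at the cost of a factor [1 / (1 - gamma)]. *)
Lemma uniform_retractions_paraconvex (beta : R) : gamma / (1 - gamma) < beta ->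
  paraconvex_valued setT beta (fun P : bexp B alpha => uniform_retractions P).
Proof.
move=> gb P c r q _ r0 Hq.
have qid : near_id P q.
  have := smallest_sub (@near_id_convex P) _ Hq; apply.
  by move=> f [[]].
have qP b : exists2 p, bexp_set P p & `|q b - p| < gamma * r.
  apply: (paraconvex_lt (bexp_paraconvex P) alpha_gamma r0 (c := c b)).
  pose X := [set h : Cb B B | convex_hull (bexp_set P `&` ball (c b) r) (h b)].
  suff : X q by [].
  apply: smallest_sub Hq; rewrite /X.
    apply/convex_setP => f g t fX gX t01.
    have /convex_setP := @convex_hull_convex R B (bexp_set P `&` ball (c b) r).
    exact.
  move=> f [[fP _]]; rewrite -ball_normE /= => cf; apply: sub_gen_smallest.
  split; first exact: fP.
  by rewrite -ball_normE /=; exact: le_lt_trans (Cb_dist_ge c f b) cf.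
have [cq _] := CbP q.
have [||g gP gq] := uniform_retractions_near (c := fun=> gamma * r) cq qid.
- exact: cst_continuous.
- exact: qP.
exists g => //; rewrite distrC.
apply: (@le_lt_trans _ _ (gamma * r / (1 - gamma))); last first.
  by rewrite mulrAC ltr_pM2r.
apply: Cb_dist_le => //.
move: alpha_ge0 alpha_gamma gamma1 => a0 ag g1.
by rewrite !mulr_ge0 ?invr_ge0 ?subr_ge0 ?ltW//; lra.
Qed.

(** For [Q] close to [P], the retraction [f] is bent into a map [h] that is the identity on [Q], and
    [h] is then corrected to a retraction onto [Q]. *)
Lemma uniform_retractions_lsc :
  lsc_on setT (fun P : bexp B alpha => uniform_retractions P).
Proof.
move=> P f e _ [fP fid] e0.
move: alpha_ge0 alpha_gamma gamma1 => a0 ag g1.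
(* Bending costs at most [t <= e / 4] and leaves [h] within [2 * t] of [Q]; the correction costs
   [2 * t / (1 - gamma) = e / 2]. *)
pose t := e * (1 - gamma) / 4.
have t0 : 0 < t by rewrite divr_gt0// mulr_gt0// subr_gt0.
have [d d0 Hd] := fid t t0.
(* A point within [d'] of [Q] is within [2 * d' <= d] of [P], where [f] moves points by less than
   [t]. *)
pose d' := Num.min (d / 2) t.
have d'0 : 0 < d' by rewrite lt_min t0 divr_gt0.
have d'd : 2 * d' <= d by rewrite -ler_pdivlMl// mulrC ge_min lexx.
have d't : d' <= t by rewrite ge_min lexx orbT.
apply: filterS (nbhsx_ballx P d' d'0) => Q PQ.
have PtoQ := bexp_ball PQ; have QtoP := bexp_ball (ball_sym PQ).
have [Q0 _ _] := bexp_paraconvex Q.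
have [cf _] := CbP f.
(* A cutoff equal to 1 on [Q] and to 0 at distance [d'] or more, used to interpolate between the
   identity and [f]. *)
pose lam b := Num.max 0 (1 - dist_set Q b / d').
have lam0 b : 0 <= lam b by rewrite le_max lexx.
have lam1 b : lam b <= 1.
  by rewrite ge_max ler01 lerBlDr lerDl divr_ge0 ?dist_set_ge0// ltW.
have clam : continuous lam.
  move=> b; apply: (@continuous_max R B (fun=> 0)); first exact: cvg_cst.
  apply: cvgB; first exact: cvg_cst.
  by apply: cvgMr_tmp; exact: dist_set_continuous.
have fb_lt b : dist_set Q b < d' -> `|f b - b| < t.
  move=> /(dist_set_lt Q0)[q Qq bq]; have [p Pp pq] := QtoP q Qq.
  apply: (Hd p) => //; have := ler_distD q b p; rewrite (distrC q p); lra.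
pose h b := f b + lam b *: (b - f b).
have ch : continuous h.
  move=> b; apply: cvgD; first exact: cf.
  by apply: cvgZ; [exact: clam|apply: cvgB; [exact: cvg_id|exact: cf]].
have hf b : `|h b - f b| <= t.
  rewrite /h addrAC subrr add0r normrZ ger0_norm//.
  have [bd|db] := ltP (dist_set Q b) d'.
    rewrite distrC -[leRHS]mul1r ler_pM//; exact/ltW/fb_lt.
  rewrite /lam max_l; first by rewrite mul0r ltW.
  by rewrite subr_le0 ler_pdivlMr ?mul1r.
have hid : near_id Q h.
  (* Within [d'] of [Q], [h] moves [b] by at most [dist_set Q b / d' * t]. *)
  move=> e1 e10; exists (Num.min d' (d' * (e1 / t))).
    by rewrite lt_min d'0 mulr_gt0// divr_gt0.
  move=> q b Qq; rewrite lt_min => /andP[bq1 bq2].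
  have bd := dist_set_le b Qq.
  have fbt := fb_lt b (le_lt_trans bd bq1).
  have -> : h b - b = (1 - lam b) *: (f b - b).
    by rewrite /h scalerBl scale1r addrAC -scalerN opprB.
  rewrite normrZ ger0_norm ?subr_ge0//.
  apply: (@le_lt_trans _ _ (dist_set Q b / d' * t)).
    apply: ler_pM; rewrite ?subr_ge0//; last exact: ltW.
    by have : 1 - dist_set Q b / d' <= lam b; [rewrite le_max lexx orbT|lra].
  rewrite -ltr_pdivlMr// ltr_pdivrMr// mulrC.
  exact: le_lt_trans bq2.
have [|b|g gQ gh] := uniform_retractions_near (c := fun=> 2 * t) ch hid.
  exact: cst_continuous.
  have [q Qq qf] := PtoQ _ (fP b); exists q => //.
  have := hf b; have := ler_distD (f b) (h b) q; rewrite (distrC (f b) q); lra.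
exists g => //; apply: (@le_lt_trans _ _ (e * (3 / 4))); last first.
  by rewrite gtr_pMr//; lra.
apply: Cb_dist_le => [|b]; first by rewrite mulr_ge0 ?ltW//; lra.
have te : t <= e / 4.
  by rewrite /t ler_pM2r// ger_pMr//; lra.
have : 2 * t / (1 - gamma) = e / 2.
  by rewrite /t; field; lra.
have := hf b; have := gh b; have := ler_distD (h b) (g b) (f b); rewrite /=.
lra.
Qed.

End uniform_retractions_paraconvex.

(** * Selection of retractions over the hyperspace *)

Lemma bexp_retraction_selection (R : realType) (B : completeNormedModType R)
    (alpha : R) (P0 : bexp B alpha) : 0 <= alpha -> alpha < 1 / 2 ->
  exists G : bexp B alpha -> Cb B B,
    continuous G /\ forall P : bexp B alpha, continuous_retraction P (G P).
Proof.
(* The midpoint keeps [gamma] strictly between [alpha] and [1 / 2], hence [gamma / (1 - gamma) < 1];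
   [beta] then lies strictly between this quotient and 1. *)
move=> a0 a1; pose gamma := (alpha + 1 / 2) / 2.
have ag : alpha < gamma by rewrite /gamma; lra.
have g1 : gamma < 1 by rewrite /gamma; lra.
have gg : gamma / (1 - gamma) < 1.
  by rewrite ltr_pdivrMr ?subr_gt0// mul1r /gamma; lra.
have gg0 : 0 <= gamma / (1 - gamma) by rewrite divr_ge0// /gamma; lra.
pose beta := (gamma / (1 - gamma) + 1) / 2.
have /ex_strict_bound_gt0[N N0 P0N] := bexp_bounded P0.
(* The iteration starts at the constant 0. Points of [P] lie within [mdist P0 P + 1] of [P0], whose
   points have norm below [N]; thus retractions onto [P] have norm strictly below the chosen radius,
   which is Lipschitz in [P]. *)
have [|||||P _|G HG] := @paraconvex_selection R (bexp B alpha) setT beta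
    ((beta + 1) / 2) openT _ _ (Cb B B) (fun P => uniform_retractions P)
    (fun P => N + mdist P0 P + 2) (fun=> 0).
- by rewrite /beta; lra.
- by rewrite /beta; lra.
- by rewrite /beta; lra.
- exact: uniform_retractions_lsc a0 ag g1.
- by apply: uniform_retractions_paraconvex a0 ag g1 _ _; rewrite /beta; lra.
- have d0 := mdist_ge0 P0 P; split.
  + apply: (@lipschitz_fun_continuous R (bexp B alpha) 1) => // x z.
    by rewrite mul1r; have := metric_triangle P0 z x; rewrite (metric_sym z); lra.
  + exact: (@cst_continuous (bexp B alpha) (Cb B B) 0).
  + by lra.
  have [f [fP fid]] := uniform_retractions_nonempty a0 ag g1 P; exists f => //.
  apply: (@le_lt_trans _ _ (N + mdist P0 P + 1)); last by lra.
  apply: Cb_dist_le => [|b]; first by lra.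
  rewrite sub0r normrN.
  have PP0 : ball P (mdist P0 P + 1) P0.
    by rewrite ballEmdist /= metric_sym ltrDl.
  have [p0 /P0N /= p0N p0f] := bexp_ball PP0 (fP b).
  by have := ler_normB p0 (p0 - f b); rewrite subKr; lra.
exists G; split=> [P|P]; first by have [] := HG P I.
(* [G P] is a uniform limit of uniform retractions; taking values in the closed set [P] and fixing
   its points both pass to the limit. *)
have [_ _ GP] := HG P I; have [cG _] := CbP (G P).
split=> // [_ [b _ <-]|p Pp].
  have [_ cP _] := bexp_paraconvex P; apply: closed_approx => // e e0.
  have [f [fP _] Gf] := GP e e0; exists (f b) => //.
  exact: le_lt_trans (Cb_dist_ge (G P) f b) Gf.
apply/eqP; rewrite -subr_eq0 -normr_le0; apply/ler_addgt0Pr => e e0.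
have [f [_ fid] Gf] := GP e e0; rewrite add0r -{2}(near_id_fix fid Pp).
exact/ltW/(le_lt_trans (Cb_dist_ge (G P) f p) Gf).
Qed.

Unset Implicit Arguments.

Theorem theorem2p0 (R : realType) (B : completeNormedModType R) (alpha : R)
    (X : topologicalType) (F : X -> bexp B alpha) :
  0 <= alpha -> alpha < 1 / 2 ->
  paracompact_space X -> continuous F ->
  exists Fr : X -> Cb B B,
    continuous Fr /\ forall x : X, continuous_retraction (F x) (Fr x).
Proof.
(* A point of [X] supplies the base set for the selection; over an empty [X] the claim is
   vacuous. *)
move=> a0 a1 _ cF; have [[x0 _]|noX] := pselect (exists x : X, True); last first.
  by exists (fun=> 0); split=> x; case: noX; exists x.
have [G [cG GP]] := bexp_retraction_selection (F x0) a0 a1.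
exists (G \o F); split=> [x|x]; last exact: GP.
by apply: continuous_comp; [exact: cF|exact: cG].
Qed.
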